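(* Let $f,\bar f:[a,b]_{q,\omega}\times\mathbb{R}\times\mathbb{R}\to\mathbb{R}$ satisfy the standing assumptions listed in the context, let $\alpha,\beta\in\mathbb{R}$, and put $$\mathcal{L}[y]=\int_a^b f(t,y(qt+\omega),D_{q,\omega}y(t))\,d_{q,\omega}t,\qquad \bar{\mathcal{L}}[\bar y]=\int_a^b\bar f(t,\bar y(qt+\omega),D_{q,\omega}\bar y(t))\,d_{q,\omega}t.$$ Let $y=z(t,\bar y)$ be a transformation having a unique inverse $\bar y=\bar z(t,y)$ for all $t\in[a,b]_{q,\omega}$, such that $y(t)=z(t,\bar y(t))$, $\bar y(t)=\bar z(t,y(t))$ gives a one-to-one correspondence $y(t)\Leftrightarrow\bar y(t)$ between all functions $y\in\mathbb{E}$ satisfying $$y(a)=\alpha,\quad y(b)=\beta\qquad(\ast)$$ and all functions $\bar y\in\mathbb{E}$ satisfying $$\bar y(a)=\bar z(a,\alpha),\quad \bar y(b)=\bar z(b,\beta).\qquad(\ast\ast)$$ Suppose there exists a function $G:[a,b]_{q,\omega}\times\mathbb{R}\to\mathbb{R}$ satisfying the functional identity $$f(t,y(qt+\omega),D_{q,\omega}y(t))-\bar f(t,\bar y(qt+\omega),D_{q,\omega}\bar y(t))=D_{q,\omega}G(t,\bar y(t))$$ (for all corresponding pairs $y,\bar y$ and all $t\in[a,b]_{q,\omega}$, the right-hand side being the $q,\omega$-derivative of $t\mapsto G(t,\bar y(t))$). Then, if $\bar y^*$ yields the extremum (minimum, respectively maximum) of $\bar{\mathcal{L}}$ among $\bar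 y\in\mathbb{E}$ satisfying $(\ast\ast)$, with $\bar y^*$ itself satisfying $(\ast\ast)$, the function $y^*(t)=z(t,\bar y^*(t))$ yields the extremum (minimum, respectively maximum) of $\mathcal{L}$ among $y\in\mathbb{E}$ satisfying $(\ast)$.
   Context: Let $q\in(0,1)$ and $\omega>0$ be fixed, $\omega_0:=\frac{\omega}{1-q}$, and let $I\subseteq\mathbb{R}$ be a closed interval containing $\omega_0$; let $a,b\in I$ with $a<b$. For $k\in\mathbb{N}_0=\{0,1,2,\dots\}$ put $[k]_{q,\omega}:=\frac{\omega(1-q^k)}{1-q}$. Set $$[a,b]_{q,\omega}:=\{q^na+[n]_{q,\omega}:n\in\mathbb{N}_0\}\cup\{q^nb+[n]_{q,\omega}:n\in\mathbb{N}_0\}\cup\{\omega_0\},\qquad [s]_{q,\omega}:=\{q^ns+[n]_{q,\omega}:n\in\mathbb{N}_0\}\cup\{\omega_0\}\ (s\in I).$$ Hahn derivative: $D_{q,\omega}f(t):=\frac{f(qt+\omega)-f(t)}{(qt+\omega)-t}$ if $t\ne\omega_0$, and $D_{q,\omega}f(\omega_0):=f'(\omega_0)$, provided $f$ is differentiable at $\omega_0$. For functions on $[a,b]_{q,\omega}$ the same formula is used (the derivative at $\omega_0$ being taken along $[a,b]_{q,\omega}$). Jackson–Nörlund integral: $\int_{\omega_0}^{x}f(t)\,d_{q,\omega}t:=(x(1-q)-\omega)\sum_{k=0}^{\infty}q^kf(xq^k+[k]_{q,\omega})$ and $\int_a^b f\,d_{q,\omega}t:=\int_{\omega_0}^b f\,d_{q,\omega}t-\int_{\omega_0}^a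 f\,d_{q,\omega}t$, provided the series converge at $x=a$ and $x=b$. $\mathcal{D}$ is the set of all functions $[a,b]_{q,\omega}\to\mathbb{R}$ continuous at $\omega_0$. $\mathbb{E}$ is the linear space of $y\in\mathcal{D}$ whose $q,\omega$-derivative is bounded on $[a,b]_{q,\omega}$ and continuous at $\omega_0$. ''Admissible'' means: $y\in\mathbb{E}$ satisfying $(\ast)$ for the functional $\mathcal{L}$ (Lagrangian $f$), and $\bar y\in\mathbb{E}$ satisfying $(\ast\ast)$ for $\bar{\mathcal{L}}$ (Lagrangian $\bar f$). An admissible variation is an $h\in\mathbb{E}$ with $h(a)=h(b)=0$. $\partial_2,\partial_3$ denote partial derivatives in the second and third arguments. A function $g(t,\cdot)$ is differentiable at $\theta_0$ uniformly in $t\in[s]_{q,\omega}$ if for every $\varepsilon>0$ there is $\delta>0$ such that $0<|\theta-\theta_0|<\delta$ implies $\left|\frac{g(t,\theta)-g(t,\theta_0)}{\theta-\theta_0}-\partial_2g(t,\theta_0)\right|<\varepsilon$ for all $t\in[s]_{q,\omega}$, where $\partial_2 g=\partial g/\partial\theta$. Standing assumptions, for $\Phi=f$ and for $\Phi=\bar f$ (with the corresponding notion of admissible function): (1) $(u,v)\mapsto\Phi(t,u,v)$ is $C^1(\mathbb{R}^2,\mathbb{R})$ for every $t\in[a,b]_{q,\omega}$; (2) for every admissible $y$, the functions $\Phi(\cdot,y(\cdot),D_{q,\omega}y(\cdot))$, $\partial_2\Phi(\cdot,y(\cdot),D_{q,\omega}y(\cdot))$, $\partial_3\Phi(\cdot,y(\cdot),D_{q,\omega}y(\cdot))$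 are continuous at $\omega_0$; (3) for every admissible $y$ and admissible variation $h$, the function $g(t,\varepsilon)=\Phi(t,y(qt+\omega)+\varepsilon h(qt+\omega),D_{q,\omega}y(t)+\varepsilon D_{q,\omega}h(t))$, defined for $\varepsilon$ in some interval $]-\bar\varepsilon,\bar\varepsilon[$, is such that $g(t,\cdot)$ is differentiable at $0$ uniformly in $t\in[a]_{q,\omega}$ and uniformly in $t\in[b]_{q,\omega}$, the integrals $\int_{\omega_0}^a g(t,\varepsilon)\,d_{q,\omega}t$ and $\int_{\omega_0}^b g(t,\varepsilon)\,d_{q,\omega}t$ exist for $\varepsilon$ near $0$, and $\int_{\omega_0}^a\partial_2g(t,0)\,d_{q,\omega}t$ and $\int_{\omega_0}^b\partial_2g(t,0)\,d_{q,\omega}t$ exist. *)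

(* Defs.v *)
(* MathComp-Analysis, over an arbitrary [R : realType].

   Functions on the q,omega-lattice [a,b]_{q,omega} are represented by total
   functions on [R]; only their values on the lattice are ever used, limits at
   [w0] are taken along the lattice, and two such functions are identified when
   they agree on the lattice. *)
From mathcomp Require Import all_boot all_order all_algebra.
From mathcomp Require Import all_classical all_reals all_analysis.
Set Implicit Arguments.
Unset Strict Implicit.
Unset Printing Implicit Defensive.
Import Order.TTheory GRing.Theory Num.Theory.
Import numFieldNormedType.Exports.
Local Open Scope classical_set_scope.
Local Open Scope ring_scope.

Section HahnCalculus.
Context {R : realType}.
Variables q w : R.

Definition omega0 : R := w / (1 - q).

Definition qwnum (k : nat) : R := w * (1 - q ^+ k) / (1 - q).

(* [s]_{q,omega} *)
Definition qworbit (s : R) : set R :=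
  [set q ^+ n * s + qwnum n | n in [set: nat]] `|` [set omega0].

(* [a,b]_{q,omega} *)
Definition qwlattice (a b : R) : set R :=
  [set q ^+ n * a + qwnum n | n in [set: nat]] `|`
  [set q ^+ n * b + qwnum n | n in [set: nat]] `|` [set omega0].

(* The Jackson-Norlund integral from omega0 to [x]; [lim] is meaningful only
   when the series converges, which is [jn_integrable0]. *)
Definition jn_term (f : R -> R) (x : R) (k : nat) : R :=
  q ^+ k * f (x * q ^+ k + qwnum k).

Definition jn_integrable0 (f : R -> R) (x : R) : Prop :=
  cvgn (series (jn_term f x)).

Definition jn_integral0 (f : R -> R) (x : R) : R :=
  (x * (1 - q) - w) * limn (series (jn_term f x)).

Definition jn_integral (f : R -> R) (a b : R) : R :=
  jn_integral0 f b - jn_integral0 f a.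

Section Lattice.
Variables a b : R.
Local Notation S := (qwlattice a b).

Definition continuous_omega0 (y : R -> R) : Prop :=
  y t @[t --> within S (nbhs omega0)] --> y omega0.

(* Difference quotient at omega0, with its limit along the lattice punctured
   at omega0. *)
Definition quot_omega0 (y : R -> R) (t : R) : R :=
  (y t - y omega0) / (t - omega0).

Definition qw_derivable (y : R -> R) : Prop :=
  cvg (quot_omega0 y t @[t --> within S omega0^']).

Definition qw_derive (y : R -> R) (t : R) : R :=
  if t == omega0 then lim (quot_omega0 y s @[s --> within S omega0^'])
  else (y (q * t + w) - y t) / ((q * t + w) - t).

(* The space E. *)
Definition qwE : set (R -> R) := [set y |
  [/\ continuous_omega0 y,
      qw_derivable y,
      [bounded qw_derive y t | t in S] &
      continuous_omega0 (qw_derive y)]].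

Definition admissible (ya yb : R) : set (R -> R) :=
  [set y | [/\ qwE y, y a = ya & y b = yb]].

Definition admissible_variation : set (R -> R) :=
  [set h | [/\ qwE h, h a = 0 & h b = 0]].

Definition functional (Phi : R -> R -> R -> R) (y : R -> R) : R :=
  jn_integral (fun t => Phi t (y (q * t + w)) (qw_derive y t)) a b.

End Lattice.
End HahnCalculus.

Section Lagrangians.
Context {R : realType}.

Definition partial2 (Phi : R -> R -> R -> R) (t u v : R) : R :=
  derive1 (fun u' => Phi t u' v) u.

Definition partial3 (Phi : R -> R -> R -> R) (t u v : R) : R :=
  derive1 (fun v' => Phi t u v') v.

Definition C1_uv (Phi : R -> R -> R -> R) (t : R) : Prop :=
  [/\ forall u v, derivable (fun u' => Phi t u' v) u 1,
      forall u v, derivable (fun v' => Phi t u v') v 1,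
      continuous (fun p : R * R => partial2 Phi t p.1 p.2) &
      continuous (fun p : R * R => partial3 Phi t p.1 p.2)].

Definition unif_differentiable (g : R -> R -> R) (th0 : R) (A : set R) : Prop :=
  forall eps : R, 0 < eps -> exists2 delta : R, 0 < delta &
    forall th : R, 0 < `|th - th0| < delta -> forall t, A t ->
      `|(g t th - g t th0) / (th - th0) - derive1 (g t) th0| < eps.

(* [Adm] is the set of admissible functions for the Lagrangian [Phi]. *)
Definition standing_assumptions (q w a b : R) (Adm : set (R -> R))
    (Phi : R -> R -> R -> R) : Prop :=
  [/\ forall t, qwlattice q w a b t -> C1_uv Phi t,
      forall y, Adm y ->
        let Dy := qw_derive q w a b y in
        [/\ continuous_omega0 q w a b (fun t => Phi t (y t) (Dy t)),
            continuous_omega0 q w a b (fun t => partial2 Phi t (y t) (Dy t)) &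
            continuous_omega0 q w a b (fun t => partial3 Phi t (y t) (Dy t))] &
      forall y h, Adm y -> admissible_variation q w a b h ->
        let g t e := Phi t (y (q * t + w) + e * h (q * t + w))
          (qw_derive q w a b y t + e * qw_derive q w a b h t) in
        forall x, x = a \/ x = b ->
          [/\ unif_differentiable g 0 (qworbit q w x),
              \forall e \near (0 : R), jn_integrable0 q w (fun t => g t e) x &
              jn_integrable0 q w (fun t => derive1 (g t) 0) x]].

Definition corresponding (S : set R) (z zbar : R -> R -> R)
    (y ybar : R -> R) : Prop :=
  forall t, S t -> y t = z t (ybar t) /\ ybar t = zbar t (y t).

(* [rel] is a one-to-one correspondence between the classes of [A] and [B]
   modulo equality on [S]. *)
Definition one_to_one_on (S : set R) (A B : set (R -> R))
    (rel : (R -> R) -> (R -> R) -> Prop) : Prop :=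
  (forall y, A y -> exists2 ybar, B ybar /\ rel y ybar &
     forall ybar', B ybar' -> rel y ybar' -> {in S, ybar' =1 ybar}) /\
  (forall ybar, B ybar -> exists2 y, A y /\ rel y ybar &
     forall y', A y' -> rel y' ybar -> {in S, y' =1 y}).

Definition minimizes (L : (R -> R) -> R) (A : set (R -> R)) (y : R -> R) : Prop :=
  A y /\ forall y', A y' -> L y <= L y'.

Definition maximizes (L : (R -> R) -> R) (A : set (R -> R)) (y : R -> R) : Prop :=
  A y /\ forall y', A y' -> L y' <= L y.

End Lagrangians.

(* Main.v *)
(* Along the orbit x_k of x under t |-> q t + w one has
   x_(k+1) - x_k = - q^k (x (1 - q) - w), so the Jackson-Norlund series of a
   Hahn derivative telescopes: the integral of D G from omega0 to x is
   G x - G omega0.  Hence the two functionals differ, on corresponding pairs,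
   by the constant G b (zbar b beta) - G a (zbar a alpha), and a one-to-one
   correspondence between the competitors transports extrema. *)
Require Import Defs.
From mathcomp Require Import all_boot all_order all_algebra.
From mathcomp Require Import all_classical all_reals all_analysis.
From mathcomp Require Import ring.
Import Order.TTheory GRing.Theory Num.Theory.
Import numFieldNormedType.Exports.
Local Open Scope classical_set_scope.
Local Open Scope ring_scope.


Section HahnOrbit.
Set Implicit Arguments.
Unset Strict Implicit.
Context {R : realType}.
Variables (q w : R).
Hypothesis hq : 0 < q < 1.
Local Notation w0 := (omega0 q w).

(** * Orbits of [t |-> q t + w] and limits along the lattice *)

Definition orbit_point (x : R) (k : nat) : R := x * q ^+ k + qwnum q w k.

Lemma subr1q_neq0 : 1 - q != 0.
Proof. by case/andP: hq => _ q1; rewrite subr_eq0 gt_eqF. Qed.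

(** As [w0] is the fixed point of [t |-> q t + w], each iteration scales the displacement from it by
    [q]. *)
Lemma orbit_pointE x k : orbit_point x k = w0 + (x - w0) * q ^+ k.
Proof. by rewrite /orbit_point /qwnum /omega0; field; exact: subr1q_neq0. Qed.

Lemma orbit_point0 x : orbit_point x 0 = x.
Proof. by rewrite orbit_pointE expr0 mulr1 addrC subrK. Qed.

Lemma orbit_pointS x k : q * orbit_point x k + w = orbit_point x k.+1.
Proof.
by rewrite !orbit_pointE exprS /omega0; field; exact: subr1q_neq0.
Qed.

Lemma orbit_point_neq x k : x != w0 -> orbit_point x k != w0.
Proof.
case/andP: hq => q0 _ xw; rewrite orbit_pointE addrC -subr_eq0 addrK.
by rewrite mulf_neq0 ?subr_eq0 // expf_neq0 // gt_eqF.
Qed.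

Lemma weightE x : x * (1 - q) - w = (x - w0) * (1 - q).
Proof. by rewrite /omega0; field; exact: subr1q_neq0. Qed.

Lemma cvg_orbit_point x : orbit_point x @ \oo --> w0.
Proof.
have q1 : `|q| < 1 by case/andP: hq => q0 ?; rewrite ger0_norm // ltW.
rewrite (_ : orbit_point x = fun k => w0 + (x - w0) * q ^+ k); last first.
  by apply/funext => k; rewrite orbit_pointE.
have /(cvgMl_tmp (a := x - w0)) := cvg_expr q1.
by move=> /(cvgD (cvg_cst w0)); rewrite mulr0 addr0.
Qed.

Section Lattice.
Variables a b : R.
Local Notation S := (qwlattice q w a b).

Lemma qwlattice_orbit x k : x = a \/ x = b -> S (orbit_point x k).
Proof.
by rewrite /orbit_point mulrC; case=> ->; left; [left|right]; exists k.
Qed.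

Lemma qwlattice_endpoint x : x = a \/ x = b -> S x.
Proof. by move=> /(qwlattice_orbit 0); rewrite orbit_point0. Qed.

Lemma qwlattice_omega0 : S w0. Proof. by right. Qed.

Lemma qwlattice_shift t : S t -> S (q * t + w).
Proof.
have shift x k : q * (q ^+ k * x + qwnum q w k) + w
    = q ^+ k.+1 * x + qwnum q w k.+1.
  by have := orbit_pointS x k; rewrite /orbit_point !(mulrC x).
case=> [[|]|->]; last 1 first.
- right => /=; rewrite /omega0; field; exact: subr1q_neq0.
- by case=> k _ <-; left; left; exists k.+1 => //; rewrite shift.
- by case=> k _ <-; left; right; exists k.+1 => //; rewrite shift.
Qed.

(** An orbit started off [w0] never hits it, so limits along the punctured lattice can be tested on
    that orbit. *)
Lemma cvg_orbit_within x : x = a \/ x = b -> x != w0 ->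
  orbit_point x @ \oo --> within S w0^'.
Proof.
move=> xab xw A wA.
have wA' : \forall t \near w0, t != w0 -> S t -> A t by exact: wA.
have {wA'} := cvg_orbit_point x wA'; apply: (@filterS nat \oo) => k.
by move=> /(_ (orbit_point_neq k xw)); apply; exact: qwlattice_orbit.
Qed.

Lemma within_punctured_proper : a < b -> ProperFilter (within S w0^').
Proof.
(* Since [a < b], at least one endpoint differs from [w0]; its orbit eventually enters every set of
   the filter, so none is empty. *)
move=> ab; have [x xab xw] : exists2 x, x = a \/ x = b & x != w0.
  have [aw|aw] := eqVneq a w0; last by exists a => //; left.
  by exists b; [right|rewrite -aw gt_eqF].
split; first by move=> /(cvg_orbit_within xab xw) [N _ /(_ N (leqnn N))].
exact: within_filter.
Qed.

(** Differentiability at [w0] forces continuity there: the increment of [H] is a convergent quotient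
    times a displacement tending to 0. *)
Lemma qw_derivable_cvg_orbit (H : R -> R) x : x = a \/ x = b -> x != w0 ->
  qw_derivable q w a b H -> H (orbit_point x k) @[k --> \oo] --> H w0.
Proof.
move=> xab xw dH; have xoo := cvg_orbit_within xab xw.
set l := lim (quot_omega0 q w H t @[t --> within S w0^']).
have quot_l : quot_omega0 q w H (orbit_point x k) @[k --> \oo] --> l.
  exact: (cvg_comp _ _ xoo dH).
have -> : (fun k => H (orbit_point x k)) = fun k =>
    H w0 + quot_omega0 q w H (orbit_point x k) * (orbit_point x k - w0).
  apply/funext => k; rewrite /quot_omega0 divfK ?subrKC //.
  by rewrite subr_eq0 orbit_point_neq.
have := cvgD (cvg_cst (H w0))
  (cvgM quot_l (cvgB (cvg_orbit_point x) (cvg_cst w0))).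
by rewrite subrr mulr0 addr0; exact.
Qed.

(** * Telescoping of the Jackson-Norlund series *)

Lemma jn_term_derive (H : R -> R) x k : x != w0 ->
  (x * (1 - q) - w) * jn_term q w (qw_derive q w a b H) x k
  = H (orbit_point x k) - H (orbit_point x k.+1).
Proof.
move=> xw; rewrite /jn_term -/(orbit_point x k) /qw_derive.
rewrite (negbTE (orbit_point_neq k xw)) orbit_pointS weightE.
have -> : orbit_point x k.+1 - orbit_point x k
    = - ((x - w0) * (1 - q) * q ^+ k) by rewrite !orbit_pointE exprS; ring.
have xw' : x - w0 != 0 by rewrite subr_eq0.
have q0 : q ^+ k != 0 by case/andP: hq => q0 _; rewrite expf_neq0 ?gt_eqF.
by field; rewrite subr1q_neq0 xw' q0.
Qed.

Lemma series_jn_term_derive (H : R -> R) x n : x != w0 ->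
  (x * (1 - q) - w) * series (jn_term q w (qw_derive q w a b H) x) n
  = H x - H (orbit_point x n).
Proof.
move=> xw; rewrite /series /= mulr_sumr.
rewrite (telescope_sumr_eq (fun k => - H (orbit_point x k))) //.
  by rewrite orbit_point0 opprK addrC.
by move=> k _; rewrite jn_term_derive // opprK addrC.
Qed.

Lemma jn_integral0_diff (F Fbar H : R -> R) x : x = a \/ x = b ->
  jn_integrable0 q w F x -> jn_integrable0 q w Fbar x ->
  qw_derivable q w a b H ->
  (forall t, S t -> F t - Fbar t = qw_derive q w a b H t) ->
  jn_integral0 q w F x - jn_integral0 q w Fbar x = H x - H w0.
Proof.
move=> xab iF iFbar dH FH; rewrite /jn_integral0 -mulrBr.
(* At [x = w0] the weight [x (1 - q) - w] vanishes and both sides are 0. *)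
have [->|xw] := eqVneq x w0; first by rewrite weightE !subrr !mul0r.
set c := x * (1 - q) - w.
(* Both sides are limits of the same weighted partial sums, once as a difference of two convergent
   series and once in telescoped form. *)
apply: (@cvg_unique R) (cvgMl_tmp (a := c) (cvgB iF iFbar)) _ => //=.
have -> : (fun n => c * (series (jn_term q w F x) - series (jn_term q w Fbar x)) n)
    = fun n => H x - H (orbit_point x n).
  apply/funext => n; rewrite -series_jn_term_derive //; congr (_ * _).
  rewrite fctE /series /= -sumrB; apply: eq_bigr => k _.
  by rewrite /jn_term -mulrBr FH //; exact: qwlattice_orbit.
by apply: cvgB; [exact: cvg_cst|exact: qw_derivable_cvg_orbit].
Qed.

(** * Invariance under equality on the lattice *)

Lemma quot_omega0_congr (y y' : R -> R) : (forall t, S t -> y t = y' t) ->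
  (quot_omega0 q w y t @[t --> within S w0^'])
  = (quot_omega0 q w y' t @[t --> within S w0^']).
Proof.
move=> yy'; have near_yy' : \forall t \near within S w0^',
    quot_omega0 q w y t = quot_omega0 q w y' t.
  rewrite near_withinE; near=> t => St.
  by rewrite /quot_omega0 (yy' _ St) (yy' _ qwlattice_omega0).
apply/seteqP; split; apply: near_eq_cvg => //.
by apply: filterS near_yy' => t ->.
Unshelve. all: by end_near. Qed.

Lemma qw_derive_congr (y y' : R -> R) : (forall t, S t -> y t = y' t) ->
  forall t, S t -> qw_derive q w a b y t = qw_derive q w a b y' t.
Proof.
move=> yy' t St; rewrite /qw_derive (quot_omega0_congr yy').
by rewrite (yy' _ St) (yy' _ (qwlattice_shift St)).
Qed.

Lemma continuous_omega0_congr (y y' : R -> R) :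
  (forall t, S t -> y t = y' t) ->
  continuous_omega0 q w a b y -> continuous_omega0 q w a b y'.
Proof.
move=> yy'; rewrite /continuous_omega0 -(yy' _ qwlattice_omega0).
apply: cvg_trans; apply: near_eq_cvg.
by rewrite near_withinE; near=> t => St; rewrite yy'.
Unshelve. all: by end_near. Qed.

Lemma qwE_congr (y y' : R -> R) : (forall t, S t -> y t = y' t) ->
  qwE q w a b y -> qwE q w a b y'.
Proof.
move=> yy' [cy dy bDy cDy]; have Dyy' := qw_derive_congr yy'.
split.
- exact: continuous_omega0_congr cy.
- by rewrite /qw_derivable -(quot_omega0_congr yy').
- case: bDy => M [Mreal bM]; exists M; split=> // N MN t St /=.
  by rewrite -Dyy' //; exact: bM.
- exact: continuous_omega0_congr cDy.
Qed.

(** Serves to replace the partner supplied by the correspondence, known only on the lattice, by the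
    explicit formula through [z]. *)
Lemma admissible_congr ya yb (y y' : R -> R) :
  (forall t, S t -> y t = y' t) ->
  admissible q w a b ya yb y -> admissible q w a b ya yb y'.
Proof.
move=> yy' [Ey ya_ yb_]; split; first exact: qwE_congr Ey.
- by rewrite -yy' //; apply: qwlattice_endpoint; left.
- by rewrite -yy' //; apply: qwlattice_endpoint; right.
Qed.

(** * The zero variation and convergence of the functionals *)

Lemma qw_derive0 : a < b -> qw_derive q w a b (cst 0) = cst 0.
Proof.
(* Properness of the filter is what makes the [lim] of the zero quotient at [w0] equal to 0. *)
move=> /within_punctured_proper properS; apply/funext => t.
rewrite /qw_derive /= subrr mul0r; case: ifP => // _.
rewrite (_ : quot_omega0 _ _ _ = cst 0) ?lim_cst //.
by apply/funext => s; rewrite /quot_omega0 subrr mul0r.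
Qed.

Lemma admissible_variation0 : a < b -> admissible_variation q w a b (cst 0).
Proof.
move=> ab; split => //; split; rewrite ?qw_derive0 //.
- exact: cvg_cst.
- rewrite /qw_derivable (_ : quot_omega0 _ _ _ = cst 0); first exact: is_cvg_cst.
  by apply/funext => s; rewrite /quot_omega0 subrr mul0r.
- exists 0; split=> [|M M0 t _ /=]; first exact: real0.
  have norm0M : `|0 : R| <= M by rewrite normr0 ltW.
  exact: norm0M.
- exact: cvg_cst.
Unshelve. all: by end_near. Qed.

(* The integrals in the standing assumptions are those of y + e h; taking
   e = 0 (and h = 0) yields convergence of the integral defining L[y]. *)
Lemma standing_integrable (Adm : set (R -> R)) (Phi : R -> R -> R -> R)
    (y : R -> R) x : a < b -> x = a \/ x = b ->
  standing_assumptions q w a b Adm Phi -> Adm y ->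
  jn_integrable0 q w
    (fun t => Phi t (y (q * t + w)) (qw_derive q w a b y t)) x.
Proof.
move=> ab xab [_ _ /(_ y (cst 0))] + Admy.
move=> /(_ Admy (admissible_variation0 ab) x xab) [_ + _].
move=> near0; have := nbhs_singleton near0.
set g := (X in jn_integrable0 q w X x) => ig.
rewrite (_ : (fun t => _) = g) //; apply/funext => t.
by rewrite /g !mul0r !addr0.
Qed.

(** The integrals up to [b] and up to [a] both contribute [- H w0], which cancels in their
    difference. *)
Lemma functional_diff (A B : set (R -> R)) (f fbar : R -> R -> R -> R)
    (y ybar H : R -> R) : a < b ->
  standing_assumptions q w a b A f -> standing_assumptions q w a b B fbar ->
  A y -> B ybar -> qw_derivable q w a b H ->
  (forall t, S t ->
     f t (y (q * t + w)) (qw_derive q w a b y t)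
     - fbar t (ybar (q * t + w)) (qw_derive q w a b ybar t)
     = qw_derive q w a b H t) ->
  functional q w a b f y = functional q w a b fbar ybar + (H b - H a).
Proof.
move=> ab sf sfbar Ay By dH FH; rewrite /functional /jn_integral.
have diff x : x = a \/ x = b -> _ := fun xab => jn_integral0_diff xab
  (standing_integrable ab xab sf Ay) (standing_integrable ab xab sfbar By) dH FH.
have /eqP := diff a (or_introl erefl); rewrite subr_eq => /eqP ->.
have /eqP := diff b (or_intror erefl); rewrite subr_eq => /eqP ->.
by ring.
Qed.

End Lattice.
End HahnOrbit.

(** * Transport of extrema through the correspondence *)

Theorem lemma3p4 (R : realType) (q w : R) (hq : 0 < q < 1) (hw : 0 < w)
  (I : set R) (hI : is_interval I) (cI : closed I) (hI0 : I (omega0 q w))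
  (a b : R) (ha : I a) (hb : I b) (hab : a < b)
  (f fbar : R -> R -> R -> R) (alpha beta : R) (z zbar : R -> R -> R)
  (hf : standing_assumptions q w a b (admissible q w a b alpha beta) f)
  (hfbar : standing_assumptions q w a b
     (admissible q w a b (zbar a alpha) (zbar b beta)) fbar)
  (hz : forall t, qwlattice q w a b t ->
     cancel (z t) (zbar t) /\ cancel (zbar t) (z t))
  (hcorr : one_to_one_on (qwlattice q w a b)
     (admissible q w a b alpha beta)
     (admissible q w a b (zbar a alpha) (zbar b beta))
     (corresponding (qwlattice q w a b) z zbar))
  (hG : exists G : R -> R -> R, forall y ybar : R -> R,
     admissible q w a b alpha beta y ->
     admissible q w a b (zbar a alpha) (zbar b beta) ybar ->
     corresponding (qwlattice q w a b) z zbar y ybar ->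
     qw_derivable q w a b (fun t => G t (ybar t)) /\
     forall t, qwlattice q w a b t ->
       f t (y (q * t + w)) (qw_derive q w a b y t)
       - fbar t (ybar (q * t + w)) (qw_derive q w a b ybar t)
       = qw_derive q w a b (fun t => G t (ybar t)) t)
  (ystar : R -> R) :
  (minimizes (functional q w a b fbar)
     (admissible q w a b (zbar a alpha) (zbar b beta)) ystar ->
   minimizes (functional q w a b f)
     (admissible q w a b alpha beta) (fun t => z t (ystar t))) /\
  (maximizes (functional q w a b fbar)
     (admissible q w a b (zbar a alpha) (zbar b beta)) ystar ->
   maximizes (functional q w a b f)
     (admissible q w a b alpha beta) (fun t => z t (ystar t))).
Proof.
have [G GP] := hG; have [toB toA] := hcorr.
set A := admissible q w a b alpha beta.
set B := admissible q w a b (zbar a alpha) (zbar b beta).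
(* This is [H b - H a] for [H t = G t (ybar t)]; the endpoint values of [ybar] are prescribed, so it
   is the same for all pairs. *)
pose c := G b (zbar b beta) - G a (zbar a alpha).
have functionalE y ybar : A y -> B ybar ->
    corresponding (qwlattice q w a b) z zbar y ybar ->
    functional q w a b f y = functional q w a b fbar ybar + c.
  move=> Ay By rel; have [dG GE] := GP y ybar Ay By rel.
  rewrite (functional_diff hq hab hf hfbar Ay By dG GE).
  by case: By => _ -> ->.
have zstar : B ystar -> A (fun t => z t (ystar t)) /\
    functional q w a b f (fun t => z t (ystar t))
    = functional q w a b fbar ystar + c.
  (* The partner [y] of [ystar] agrees with [z t (ystar t)] on the lattice, so admissibility passes
     to the latter; the inverse [zbar] then shows that it corresponds to [ystar]. *)
  move=> Bstar; have [y [Ay rel] _] := toA _ Bstar.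
  have Az : A (fun t => z t (ystar t)).
    by apply: (admissible_congr hq _ Ay) => t /rel[].
  split=> //; apply: functionalE => // t St; split=> //.
  by have [zK _] := hz t St; rewrite zK.
(* Every competitor [y] has a partner [ybar], and adding [c] preserves the inequality in either
   direction. *)
split=> -[Bstar opt]; have [Az Lz] := zstar Bstar; split=> // y Ay;
  have [ybar [By rel] _] := toB _ Ay;
  by rewrite Lz (functionalE _ _ Ay By rel) lerD2r; exact: opt.
Qed.
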